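(* Let $R$ be a semiring, $V$ an $R$-module, and $D$ any submodule of $V$. Then the subtractive hull $T$ of $D$ in $V$ is complementary over $D$ to every SA-extension $A$ of $D$ in $V$; that is, for every submodule $A$ of $V$ which contains $D$ and in which $D$ is summand absorbing, $A\cap T=D$ and $[(A\setminus D)+T]\cap T=\emptyset$.
   Context: $R$-module means left (semi)module over a semiring $R$ with $0$ and $1$; no subtraction is assumed. $D\subset A$ is summand absorbing in $A$ (and $A$ is then an SA-extension of $D$) if for all $x,y\in A$, $x+y\in D$ implies $x\in D$ and $y\in D$. A submodule $T$ of $V$ is subtractive in $V$ if for any $t_1,t_2\in T$ and $x\in V$ with $x+t_1=t_2$ also $x\in T$. The subtractive hull of $D$ in $V$ is the smallest subtractive submodule of $V$ containing $D$, i.e. the intersection of all subtractive submodules of $V$ containing $D$. *)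

(* Defs.v *)
From mathcomp Require Import all_boot all_algebra.
From mathcomp Require Import boolp classical_sets.

Set Implicit Arguments.
Unset Strict Implicit.
Unset Printing Implicit Defensive.

Import GRing.Theory.
Local Open Scope classical_set_scope.
Local Open Scope ring_scope.

Section SummandAbsorbing.
Variables (R : pzSemiRingType) (V : lSemiModType R).
Implicit Types A D T : set V.

Definition submodule D : Prop := GRing.subsemimod_closed [pred x | x \in D].

(* Meaningful for D `<=` A only; the inclusion is not part of the definition. *)
Definition summand_absorbing D A : Prop :=
  forall x y, A x -> A y -> D (x + y) -> D x /\ D y.

Definition SA_extension D A : Prop :=
  [/\ submodule A, D `<=` A & summand_absorbing D A].

Definition subtractive T : Prop :=
  forall t1 t2 x, T t1 -> T t2 -> x + t1 = t2 -> T x.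

Definition subtractive_hull D : set V :=
  smallest [set T | submodule T /\ subtractive T] D.

Definition complementary_over D A T : Prop :=
  A `&` T = D /\ [set x + y | x in A `\` D & y in T] `&` T = set0.

End SummandAbsorbing.

(* Main.v *)
(* The subtractive hull of D consists of the x with x + d in D for some d in D.
   If such an x lies in an SA-extension A of D, then summand absorption puts x
   in D, so A meets the hull T exactly in D. If a + t lies in T with a in A and
   t in T, subtractivity puts a in T, hence in D. *)
Require Import Defs.
From mathcomp Require Import all_boot all_algebra.
From mathcomp Require Import boolp classical_sets.

Import GRing.Theory.
Local Open Scope classical_set_scope.
Local Open Scope ring_scope.

Lemma submoduleP (R : pzSemiRingType) (V : lSemiModType R) (D : set V) :
  submodule D <-> [/\ D 0, forall x y, D x -> D y -> D (x + y)
                         & forall (a : R) x, D x -> D (a *: x)].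
Proof.
split=> [[[D0 DD] DZ]|[D0 DD DZ]].
  split=> [|x y /mem_set Dx /mem_set Dy|a x /mem_set Dx]; apply: set_mem.
  - exact: D0.
  - exact: DD Dx Dy.
  - exact: DZ Dx.
split; first split.
- exact: mem_set D0.
- by move=> x y /set_mem Dx /set_mem Dy; apply: mem_set (DD _ _ Dx Dy).
- by move=> a x /set_mem Dx; apply: mem_set (DZ a _ Dx).
Qed.

(** The right-hand set is itself a subtractive submodule containing [D], so it bounds the hull from
    above. Conversely, a subtractive [T] containing [D] contains both [d] and [x + d], hence [x]. *)
Lemma subtractive_hullE (R : pzSemiRingType) (V : lSemiModType R) (D : set V) :
  submodule D -> subtractive_hull D = [set x | exists2 d, D d & D (x + d)].
Proof.
move=> /submoduleP[D0 DD DZ]; apply/seteqP; split=> [x hullx|x [d Dd Dxd]].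
  apply: hullx; split; last by move=> y Dy; exists 0; rewrite ?addr0.
  split; first apply/submoduleP; first split.
  - by exists 0; rewrite ?addr0.
  - move=> y z [d Dd Dyd] [e De Dze]; exists (d + e); first exact: DD.
    by rewrite addrACA; apply: DD.
  - move=> a y [d Dd Dyd]; exists (a *: d); first exact: DZ.
    by rewrite -scalerDr; apply: DZ.
  (* From [y + t1 = t2], adding the witness to [y] gives [(t2 + e) + d], a sum of two elements of
     [D]. *)
  - move=> t1 t2 y [d Dd Dtd] [e De Dte] yt; exists (t1 + d + e); first exact: DD.
    by rewrite !addrA yt addrAC; apply: DD.
move=> T [[_ subT] DT].
by apply: (subT d (x + d)) => //; apply: DT.
Qed.

(** Subtractivity passes to arbitrary intersections: it is checked in each [T] separately. *)
Lemma subtractive_subtractive_hull (R : pzSemiRingType) (V : lSemiModType R)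
  (D : set V) : subtractive (subtractive_hull D).
Proof.
move=> t1 t2 x h1 h2 xt T hT; have [[_ subT] _] := hT.
exact: subT (h1 T hT) (h2 T hT) xt.
Qed.

Theorem theorem9p5 (R : pzSemiRingType) (V : lSemiModType R) (D : set V)
    (hD : submodule D) :
  forall A : set V, SA_extension D A ->
    complementary_over D A (subtractive_hull D).
Proof.
move=> A [_ DA absA].
have AT : A `&` subtractive_hull D = D.
  apply/seteqP; split=> [x [Ax]|x Dx].
    rewrite subtractive_hullE // => -[d Dd Dxd].
    by have [] := absA x d Ax (DA d Dd) Dxd.
  by split; [exact: DA | move=> T [_]; apply].
split=> //; apply/seteqP; split=> // _ [[a [Aa nDa] [t Tt <-]] Tat].
apply: nDa; rewrite -AT; split=> //.
exact: subtractive_subtractive_hull Tt Tat erefl.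
Qed.
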